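(* There exists an absolute constant $c>0$ such that the following holds: if $\mathcal{A}$ is a covering system of multiplicity $s$, then the smallest modulus of $\mathcal{A}$ is at most $\exp\!\big(c\log^2(s+1)/\log\log(s+2)\big)$.
   Context: A covering system is a finite set of congruence classes $\mathcal{A}=\{a_1\bmod d_1,\dots,a_n\bmod d_n\}$ (with $d_i\in\mathbb{N}$) whose union is $\mathbb{Z}$; the moduli need not be distinct. The multiplicity of a set of congruences $\mathcal{A}=\{a_1\bmod d_1,\dots,a_n\bmod d_n\}$ is $m(\mathcal{A})=\max_{d\in\mathbb{N}}\#\{1\le j\le n: d_j=d\}$. *)

(* Defs.v *)
From HB Require Import structures.
From mathcomp Require Import all_boot all_order all_algebra.
From mathcomp Require Import all_classical all_reals all_analysis.

Set Implicit Arguments.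
Unset Strict Implicit.
Unset Printing Implicit Defensive.

Import Order.TTheory GRing.Theory Num.Theory.

Local Open Scope classical_set_scope.

(* The pair (a, d) stands for the congruence class a mod d; distinct pairs may
   denote the same class. *)
Definition residue_class (c : int * nat) : set int :=
  [set x : int | (x = c.1 %[mod c.2])%Z].

Definition moduli (A : seq (int * nat)) : seq nat := [seq c.2 | c <- A].

(* A system is a set of classes, hence the classes listed in A are required to
   be pairwise distinct; their moduli may coincide. *)
Definition covering_system (A : seq (int * nat)) : Prop :=
  [/\ {in moduli A, forall d, (0 < d)%N},
      uniq [seq residue_class c | c <- A] &
      \bigcup_(c in [set` A]) residue_class c = [set: int]].

(* A modulus d that does not occur in A has count 0, so the maximum over all d
   is reached on the moduli of A. *)
Definition multiplicity (A : seq (int * nat)) : nat :=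
  \max_(d <- moduli A) count_mem d (moduli A).

(* The minimum of the moduli when A is nonempty, as any covering system is. *)
Definition smallest_modulus (A : seq (int * nat)) : nat :=
  \big[minn/head 0%N (moduli A)]_(d <- moduli A) d.

(* Main.v *)
Require Import Defs.
From HB Require Import structures.
From mathcomp Require Import all_boot all_order all_algebra.
From mathcomp Require Import all_classical all_reals all_analysis.
From mathcomp Require Import zify lra ring.

(* The proof is the distortion method. Order the primes; starting from the
   uniform measure, whenever a prime p is added, the measure is distorted on
   the fibres of Z/Mp^G -> Z/M so as to put less mass on the set B of points
   lying in a class whose modulus is divisible by p: mass is moved away from B
   as long as no density exceeds 2. If alpha is the relative density of B in a
   fibre, then B gets measure at most E[alpha^2], and a class modulo m has
   measure at most 2^omega(m) / m. For multiplicity s this gives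
   E[alpha^2] <= (2s/p)^2 S_p, where S_p is a sum over pairs of moduli with
   S_p <= exp(20 sum_(q < p) 1/q), which is a power of log p by Chebyshev's
   bound. Hence the primes above y = 2^K contribute little once K is a large
   multiple of log(s + 1). The primes below y are treated by the union bound
   for the uniform measure: s times the sum of 1/d over y-smooth d >= D is small
   by Rankin's trick as soon as log D is a large multiple of K^2 / log K. So
   some integer is left uncovered if all moduli exceed the claimed bound. *)

Set Implicit Arguments.
Unset Strict Implicit.
Unset Printing Implicit Defensive.

Import Order.TTheory GRing.Theory Num.Theory.
Local Open Scope ring_scope.

(** * Sums of reciprocals of primes *)

Lemma prod_uniq_primes_dvd (s : seq nat) (m : nat) :
  uniq s -> {in s, forall p, prime p && (p %| m)%N} ->
  (\prod_(p <- s) p %| m)%N.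
Proof.
elim: s => [|p s IHs] /=; first by rewrite big_nil dvd1n.
case/andP=> pNs us h; rewrite big_cons Gauss_dvd.
  have /andP[_ ->] := h p (mem_head _ _).
  by rewrite IHs // => q qs; apply: h; rewrite inE qs orbT.
have /andP[pp _] := h p (mem_head _ _).
rewrite prime_coprime // Euclid_dvd_prod // big_has.
apply/hasPn => q qs; have := h q; rewrite inE qs orbT => /(_ isT)/andP[pq _].
by rewrite dvdn_prime2 //; apply: contraNneq pNs => ->.
Qed.

Lemma central_bin_ub n : ('C(n + n, n) <= 4 ^ n)%N.
Proof.
rewrite -[4%N]/(2 ^ 2)%N -expnM mul2n -addnn -[2%N]/(1 + 1)%N.
rewrite expnDn.
have nlt : (n < (n + n).+1)%N by rewrite ltnS leq_addr.
rewrite (bigD1 (Ordinal nlt)) //= !exp1n !muln1.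
exact: leq_addr.
Qed.

(** In [(2n)! = 'C(2n, n) n! n!] the prime p divides the left side but not [n!]. *)
Lemma prime_dvd_central_bin n p :
  prime p -> (n < p <= n + n)%N -> (p %| 'C(n + n, n))%N.
Proof.
move=> pp /andP[np pn].
have := dvdn_fact (n := n + n) (m := p); rewrite prime_gt0 // pn => /(_ isT).
rewrite -(bin_fact (leq_addr n n)) addnK.
have pNn : ~~ (p %| n`!)%N.
  rewrite fact_prod Euclid_dvd_prod // big_has; apply/hasPn => q.
  rewrite mem_index_iota => /andP[q0 qn].
  by apply/negP => /dvdn_leq; lia.
by rewrite !Euclid_dvdM // (negPf pNn) !orbF.
Qed.

(** The primes counted exceed [2 ^ k], and their product divides a binomial coefficient of size at
    most [4 ^ (2 ^ k)]; compare exponents of 2. *)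
Lemma count_primes_dyadic k :
  (k * count prime (index_iota (2 ^ k).+1 (2 ^ k.+1).+1) <= 2 ^ k.+1)%N.
Proof.
set s := index_iota _ _.
have h : (\prod_(p <- [seq p <- s | prime p]) p %| 'C(2 ^ k + 2 ^ k, 2 ^ k))%N.
  apply: prod_uniq_primes_dvd; first by rewrite filter_uniq ?iota_uniq.
  move=> p; rewrite mem_filter mem_index_iota => /andP[pp pk].
  by rewrite pp prime_dvd_central_bin //; move: pk; rewrite expnS; lia.
have b0 : (0 < 'C(2 ^ k + 2 ^ k, 2 ^ k))%N by rewrite bin_gt0 leq_addr.
have h1 := leq_trans (dvdn_leq b0 h) (central_bin_ub _).
have h2 : ((2 ^ k) ^ count prime s <= \prod_(p <- [seq p <- s | prime p]) p)%N.
  rewrite -iter_muln_1 -big_const_seq -big_filter.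
  rewrite big_seq [leqRHS]big_seq; apply: leq_prod => p.
  by rewrite mem_filter mem_index_iota => /andP[_ /andP[/ltnW]].
move: (leq_trans h2 h1).
by rewrite -[4%N]/(2 ^ 2)%N -!expnM leq_exp2l // expnS.
Qed.

Definition prime_recip_sum (R : realType) (n : nat) : R :=
  \sum_(0 <= p < n | prime p) p%:R^-1.

Lemma sum_recip_primes_dyadic (R : realType) k : (0 < k)%N ->
  \sum_((2 ^ k).+1 <= p < (2 ^ k.+1).+1 | prime p) p%:R^-1 <= 2 / k%:R :> R.
Proof.
move=> k0.
apply: (@le_trans _ _
    (\sum_((2 ^ k).+1 <= p < (2 ^ k.+1).+1 | prime p) (2 ^ k)%:R^-1)).
  rewrite big_seq_cond [leRHS]big_seq_cond; apply: ler_sum => p.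
  rewrite mem_index_iota => /andP[/andP[kp _] _].
  have k2 : (0 < 2 ^ k)%N by rewrite expn_gt0.
  by rewrite lef_pV2 ?posrE ?ltr0n ?ler_nat; lia.
rewrite big_const_seq iter_addr_0 -[leLHS]mulr_natr.
rewrite ler_pdivlMr ?ltr0n // -mulrA ler_pdivrMl ?ltr0n ?expn_gt0 //.
by rewrite -!natrM ler_nat mulnC [leqRHS]mulnC -expnS count_primes_dyadic.
Qed.

Lemma inv_succ_le_lnB (R : realType) (k : nat) : (0 < k)%N ->
  k.+1%:R^-1 <= ln k.+1%:R - ln k%:R :> R.
Proof.
move=> k0; have kR : 0 < k%:R :> R by rewrite ltr0n.
have k1R : 0 < k.+1%:R :> R by rewrite ltr0n.
rewrite -lerN2 opprB -ln_div ?posrE //.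
have -> : k%:R / k.+1%:R = 1 + - k.+1%:R^-1 :> R.
  by rewrite -[in k.+1%:R]natr1 in k1R *; field; lra.
by apply: le_ln1Dx; rewrite ltrN2 invf_lt1 // ltr1n.
Qed.

Lemma prime_recip_sum_mono (R : realType) m n : (m <= n)%N ->
  prime_recip_sum R m <= prime_recip_sum R n.
Proof.
move=> mn; rewrite /prime_recip_sum [leRHS](@big_cat_nat _ _ _ m) //=.
by rewrite lerDl sumr_ge0.
Qed.

Lemma prime_recip_sum_le (R : realType) k : (0 < k)%N ->
  prime_recip_sum R (2 ^ k) <= 3 + 2 * ln k%:R.
Proof.
move=> k0.
have step n : (0 < n)%N -> prime_recip_sum R (2 ^ n.+1).+1 <=
   prime_recip_sum R (2 ^ n).+1 + 2 / n%:R.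
  move=> n0; rewrite /prime_recip_sum (@big_cat_nat _ _ _ (2 ^ n).+1) //=.
    by rewrite lerD2l sum_recip_primes_dyadic.
  by rewrite ltnS leq_exp2l.
(* The dyadic blocks contribute [2 / i] each, which telescopes against [2 * ln]. In the base case 3
   = 1 + 2 the prime 2 is bounded by 1 and the first block by 2. *)
have main n : prime_recip_sum R (2 ^ n.+2).+1 <= 3 + 2 * ln n.+1%:R.
  elim: n => [|n IHn].
    apply: le_trans (step 1%N isT) _.
    rewrite ln1 /prime_recip_sum -[(2 ^ 1).+1]/3%N big_mkcond.
    rewrite 2?big_nat_recr //= big_nat1 /= !add0r divr1 mulr0 addr0.
    by rewrite (natrD _ 1 2) lerD2r invf_le1 ?ler1n ?ltr0n.
  apply: le_trans (step _ _) _ => //.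
  have := @inv_succ_le_lnB R n.+1 isT; move: IHn.
  by set x := n.+2%:R^-1; set y := prime_recip_sum R _; lra.
case: k k0 => // k _; apply: le_trans (main k).
by apply: prime_recip_sum_mono; rewrite ltnW // ltnS leq_exp2l.
Qed.

(** * Sums over smooth moduli *)

(** The product of [p ^ G] over the primes p < n. Its divisors, listed by [smooth_seq], are the
    numbers with prime factors below n and exponents at most G. *)
Fixpoint smooth_mod (G n : nat) : nat :=
  if n is p.+1 then
    if prime p then (smooth_mod G p * p ^ G)%N else smooth_mod G p
  else 1%N.

Fixpoint smooth_seq (G n : nat) : seq nat :=
  if n is p.+1 then
    if prime p then
      [seq (m * p ^ k)%N | m <- smooth_seq G p, k <- index_iota 0 G.+1]
    else smooth_seq G p
  else [:: 1%N].

Lemma smooth_seqS G p : smooth_seq G p.+1 =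
  if prime p then
    [seq (m * p ^ k)%N | m <- smooth_seq G p, k <- index_iota 0 G.+1]
  else smooth_seq G p.
Proof. by []. Qed.

Lemma smooth_mod_gt0 G n : (0 < smooth_mod G n)%N.
Proof.
elim: n => //= p IHp; case: ifP => // pp.
by rewrite muln_gt0 IHp expn_gt0 prime_gt0.
Qed.

Lemma coprime_smooth_mod G n p :
  prime p -> (n <= p)%N -> coprime (smooth_mod G n) p.
Proof.
move=> pp; elim: n => [|q IHq] qp /=; first by rewrite coprime1n.
case: ifP => [pq|_]; last by apply: IHq; lia.
rewrite coprimeMl IHq 1?ltnW //= coprimeXl // prime_coprime // dvdn_prime2 //.
by apply/eqP; lia.
Qed.

Lemma dvd_mul_pfactor M p G d : (0 < M)%N -> prime p -> coprime M p ->
  (d %| M * p ^ G)%N ->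
  exists m k, [/\ (m %| M)%N, (k <= G)%N & d = (m * p ^ k)%N].
Proof.
move=> M0 pp cMp dM.
have Mp0 : (0 < M * p ^ G)%N by rewrite muln_gt0 M0 expn_gt0 prime_gt0.
have d0 := dvdn_gt0 Mp0 dM.
have [m cpm dE] := pfactor_coprime pp d0.
exists m, (logn p d); split => //.
  have := dvdn_trans (dvdn_mulr (p ^ logn p d)%N (dvdnn m)) (_ : _ %| M * p ^
      G)%N.
  rewrite -dE => /(_ dM); rewrite Gauss_dvdl //.
  by rewrite coprimeXr // coprime_sym.
have := dvdn_leq_log p Mp0 dM.
by rewrite logn_Gauss 1?coprime_sym // pfactorK.
Qed.

Lemma mem_smooth_seq G n d :
  (d %| smooth_mod G n)%N -> d \in smooth_seq G n.
Proof.
elim: n d => [|p IHp] d; first by rewrite dvdn1 inE.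
rewrite smooth_seqS /smooth_mod -/smooth_mod; case: ifP => [pp|_]; last exact:
    IHp.
case/dvd_mul_pfactor=> //; first exact: smooth_mod_gt0.
  exact: coprime_smooth_mod.
move=> m [k [/IHp mL kG ->]]; apply/allpairsP; exists (m, k).
by rewrite /= mem_index_iota.
Qed.

Lemma smooth_seq_dvd G n d :
  d \in smooth_seq G n -> (d %| smooth_mod G n)%N.
Proof.
elim: n d => [|p IHp] d; first by rewrite dvdn1 inE.
rewrite smooth_seqS /smooth_mod -/smooth_mod; case: ifP => [pp|_]; last exact:
    IHp.
case/allpairsP => -[m k] [/IHp mM /=]; rewrite mem_index_iota => kG ->.
by rewrite dvdn_mul // dvdn_exp2l.
Qed.

Lemma smooth_seq_coprime G n d p : prime p -> (n <= p)%N ->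
  d \in smooth_seq G n -> coprime d p.
Proof.
move=> pp np /smooth_seq_dvd dM.
exact: coprime_dvdl dM (coprime_smooth_mod G pp np).
Qed.

Lemma smooth_seq_gt0 G n d : d \in smooth_seq G n -> (0 < d)%N.
Proof. by move/smooth_seq_dvd; apply: dvdn_gt0; apply: smooth_mod_gt0. Qed.

Lemma dvd_smooth_mod G n d : (0 < d <= G)%N ->
  (forall p, prime p -> (p %| d)%N -> (p < n)%N) -> (d %| smooth_mod G n)%N.
Proof.
elim: n d => [|p IHp] d /andP[d0 dG] hd.
  rewrite /= dvdn1; apply: contraT => d1.
  have pp : prime (pdiv d) by rewrite pdiv_prime //; lia.
  by have := hd _ pp (pdiv_dvd d).
rewrite /=; case: ifP => [pp|np].
  have [m cpm dE] := pfactor_coprime pp d0.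
  have md : (m %| d)%N by rewrite dE dvdn_mulr.
  rewrite dE dvdn_mul //.
    apply: IHp => [|q pq qm].
      by rewrite (dvdn_gt0 d0 md) (leq_trans (dvdn_leq d0 md)).
    have := hd q pq (dvdn_trans qm md); rewrite ltnS leq_eqVlt.
    case/orP => // /eqP qE; move: cpm; rewrite prime_coprime //.
    by rewrite -qE qm.
  (* The exponent of p in d is less than d, hence at most G. *)
  rewrite dvdn_exp2l // (leq_trans _ dG) //.
  exact: ltnW (ltn_logl p d0).
apply: IHp => [|q pq qd]; first by rewrite d0.
have := hd q pq qd; rewrite ltnS leq_eqVlt => /orP[/eqP qE|//].
by rewrite -qE pq in np.
Qed.

Lemma lcm_pfactor p m1 m2 k1 k2 : coprime m1 p -> coprime m2 p ->
  lcmn (m1 * p ^ k1) (m2 * p ^ k2) = (lcmn m1 m2 * p ^ maxn k1 k2)%N.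
Proof.
move=> c1 c2; apply/eqP; rewrite eqn_dvd; apply/andP; split.
  by rewrite dvdn_lcm !dvdn_mul ?dvdn_lcml ?dvdn_lcmr ?dvdn_exp2l ?leq_maxl
    ?leq_maxr.
have c : coprime (lcmn m1 m2) p.
  apply: (@coprime_dvdl _ (m1 * m2)); last by rewrite coprimeMl c1.
  by rewrite dvdn_lcm dvdn_mulr // dvdn_mull.
rewrite Gauss_dvd ?coprimeXr // dvdn_lcm; apply/andP; split.
  apply/andP; split.
    exact: dvdn_trans (dvdn_mulr _ (dvdnn _)) (dvdn_lcml _ _).
  exact: dvdn_trans (dvdn_mulr _ (dvdnn _)) (dvdn_lcmr _ _).
case: (leqP k1 k2) => _.
  exact: dvdn_trans (dvdn_mull _ (dvdnn _)) (dvdn_lcmr _ _).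
exact: dvdn_trans (dvdn_mull _ (dvdnn _)) (dvdn_lcml _ _).
Qed.

(** * Weights of classes and sums over pairs of moduli *)

Definition class_weight (R : realType) (m : nat) : R :=
  2 ^+ size (primes m) / m%:R.

(** The local factor at [p ^ k] of the multiplicative function [class_weight]. *)
Definition pfactor_weight (R : realType) (p k : nat) : R :=
  if k is 0%N then 1 else 2 / p%:R ^+ k.

Lemma class_weight_ge0 (R : realType) m : 0 <= class_weight R m.
Proof. by rewrite /class_weight divr_ge0 // exprn_ge0. Qed.

Lemma class_weight_ge_inv (R : realType) m : m%:R^-1 <= class_weight R m.
Proof.
by rewrite /class_weight ler_peMl ?invr_ge0 // exprn_ege1 // ler1n.
Qed.

Lemma class_weight_pfactor (R : realType) m p k : (0 < m)%N -> prime p ->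
  coprime m p ->
  class_weight R (m * p ^ k) = class_weight R m * pfactor_weight R p k.
Proof.
move=> m0 pp cmp; case: k => [|k]; first by rewrite muln1 mulr1.
rewrite /class_weight.
have -> : size (primes (m * p ^ k.+1)) = (size (primes m)).+1.
  have <- : size (primes m ++ [:: p]) = (size (primes m)).+1.
    by rewrite size_cat addn1.
  apply: perm_size; apply: uniq_perm; first exact: primes_uniq.
    rewrite cat_uniq primes_uniq /= orbF andbT mem_primes pp m0 /=.
    by rewrite -prime_coprime // coprime_sym.
  move=> q; rewrite (primesM q m0) ?expn_gt0 ?prime_gt0 // mem_cat.
  by rewrite primesX // (primes_prime pp).
by rewrite natrM natrX exprSr invfM /=; ring.
Qed.

Lemma sum_primes_recr (R : realType) (b : nat -> R) n :
  \sum_(0 <= p < n.+1 | prime p) b p =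
  \sum_(0 <= p < n | prime p) b p + (if prime n then b n else 0).
Proof. by rewrite big_mkcond big_nat_recr //= -big_mkcond. Qed.

(** An Euler product as an upper bound: each prime multiplies the sum by at most [expR (b p)]. *)
Lemma sum_smooth_seq_le (R : realType) G n (f : nat -> R) (b : nat -> R) :
  f 1%N <= 1 ->
  (forall m p, prime p -> (0 < m)%N -> coprime m p ->
     \sum_(0 <= k < G.+1) f (m * p ^ k)%N <= f m * expR (b p)) ->
  \sum_(m <- smooth_seq G n) f m <= expR (\sum_(0 <= p < n | prime p) b p).
Proof.
move=> f1 hf; elim: n => [|p IHp].
  by rewrite big_seq1 big_geq // expR0.
rewrite smooth_seqS sum_primes_recr; case: ifP => pp; last by rewrite addr0.
rewrite big_allpairs_dep /= expRD.
apply: (@le_trans _ _ (\sum_(m <- smooth_seq G p) f m * expR (b p))).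
  rewrite big_seq [leRHS]big_seq; apply: ler_sum => m mL.
  apply: hf => //; first exact: smooth_seq_gt0 mL.
  exact: smooth_seq_coprime mL.
by rewrite -mulr_suml ler_wpM2r ?expR_ge0.
Qed.

(** The sum [S_n]: two classes meet in a class modulo the lcm or not at all, so second moments lead
    to weights of lcms. *)
Definition pair_sum (R : realType) (G n : nat) : R :=
  \sum_(m1 <- smooth_seq G n) \sum_(m2 <- smooth_seq G n)
    class_weight R (lcmn m1 m2).

Lemma pair_sum_ge0 (R : realType) G n : 0 <= pair_sum R G n.
Proof.
by do 2![apply: sumr_ge0 => ? _]; apply: class_weight_ge0.
Qed.

(* The remainder term makes the induction on G go through. *)
Lemma sum_pfactor_weight_max (R : realType) p G : (1 < p)%N ->
  \sum_(0 <= i < G.+1) \sum_(0 <= j < G.+1) pfactor_weight R p (maxn i j) <=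
  1 + 20 / p%:R - (8 * G%:R + 20) * p%:R^-1 ^+ G.+1.
Proof.
move=> p1; have p0 : 0 < p%:R :> R by rewrite ltr0n; lia.
set x := p%:R^-1; have x0 : 0 < x by rewrite invr_gt0.
have x2 : x <= 2^-1 by rewrite lef_pV2 ?posrE ?ler_nat.
elim: G => [|G IHG].
  by rewrite !big_nat1 /= expr1; lra.
rewrite big_nat_recr //= [X in _ + X]big_nat_recr //= maxnn.
under eq_bigr => i _ do rewrite big_nat_recr //=.
rewrite big_split /=.
have e1 : \sum_(0 <= i < G.+1) pfactor_weight R p (maxn i G.+1) =
    G.+1%:R * (2 * x ^+ G.+1).
  rewrite (eq_big_nat _ _ (F2 := fun=> 2 * x ^+ G.+1)).
    by rewrite sumr_const_nat subn0 [RHS]mulr_natl.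
  move=> i /andP[_ iG]; have -> : maxn i G.+1 = G.+1 by apply/maxn_idPr; lia.
  by rewrite /= exprVn.
have e2 : \sum_(0 <= i < G.+1) pfactor_weight R p (maxn G.+1 i) =
    G.+1%:R * (2 * x ^+ G.+1).
  by rewrite -e1; apply: eq_bigr => i _; rewrite maxnC.
rewrite e1 e2 /= -exprVn -/x.
move: IHG; set T := \sum_(_ <= _ < _) _; set y := x ^+ G.+1 => IHG.
have y0 : 0 <= y by rewrite exprn_ge0 // ltW.
have -> : x ^+ G.+2 = y * x by rewrite exprSr.
rewrite -natr1; have G0 : 0 <= G%:R :> R by [].
(* The remainder term is tuned to this: [8G + 20 - (8G + 28) x - (4G + 6)] equals
   [(8G + 28) (1/2 - x)], where [4G + 6] comes from the [2G + 3] new pairs. *)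
have : 0 <= y * ((8 * G%:R + 28) * (2^-1 - x)) by rewrite !mulr_ge0 //; lra.
lra.
Qed.

(** The weight of the lcm factors at p, and the local double sum is at most
    [1 + 20 / p <= expR (20 / p)]. *)
Lemma pair_sum_le (R : realType) G n :
  pair_sum R G n <= expR (20 * prime_recip_sum R n).
Proof.
rewrite /pair_sum; elim: n => [|p IHp].
  rewrite !big_seq1 /prime_recip_sum big_geq // mulr0 expR0.
  by rewrite /class_weight divr1.
rewrite /prime_recip_sum sum_primes_recr smooth_seqS.
case: ifP => pp; last by rewrite addr0.
rewrite big_allpairs_dep mulrDr expRD.
set E := expR (20 / _).
apply: (@le_trans _ _ (\sum_(m1 <- smooth_seq G p)
   (\sum_(m2 <- smooth_seq G p) class_weight R (lcmn m1 m2)) * E)); last first.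
  by rewrite -mulr_suml ler_wpM2r ?expR_ge0.
rewrite big_seq [leRHS]big_seq; apply: ler_sum => m1 m1L.
under eq_bigr => i _ do rewrite big_allpairs_dep.
rewrite exchange_big mulr_suml big_seq [leRHS]big_seq.
apply: ler_sum => m2 m2L.
have [c1 c2] := (smooth_seq_coprime pp (leqnn p) m1L,
                 smooth_seq_coprime pp (leqnn p) m2L).
have l0 : (0 < lcmn m1 m2)%N.
  by rewrite lcmn_gt0 (smooth_seq_gt0 m1L) (smooth_seq_gt0 m2L).
have cl : coprime (lcmn m1 m2) p.
  apply: (@coprime_dvdl _ (m1 * m2)); last by rewrite coprimeMl c1.
  by rewrite dvdn_lcm dvdn_mulr // dvdn_mull.
under eq_bigr => i _.
  under eq_bigr => j _ do rewrite lcm_pfactor // class_weight_pfactor //.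
  rewrite -mulr_sumr; over.
rewrite -mulr_sumr ler_wpM2l ?class_weight_ge0 //.
apply: le_trans (sum_pfactor_weight_max R G (prime_gt1 pp)) _.
apply: le_trans (expR_ge1Dx _); rewrite lerBlDr lerDl mulr_ge0 ?exprn_ge0 //.
Qed.

(** * Distortion of measures *)

(** The mean over the fibre of Z/Mq -> Z/M through x. Working with functions on [nat] lets the
    modulus grow without changing types. *)
Definition average (R : realType) (M q : nat) (f : nat -> R) (x : nat) : R :=
  q%:R^-1 * \sum_(0 <= t < q) f (x + M * t)%N.

(** Probability measures are encoded as linear, monotone, normalised functionals on functions of a
    natural number. *)
Definition expectation (R : realType) (F : (nat -> R) -> R) : Prop :=
  [/\ forall a f g, F (fun x => a * f x + g x) = a * F f + F g,
      forall f g, (forall x, f x <= g x) -> F f <= F g &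
      F (fun=> 1) = 1].

Lemma expectation_sum (R : realType) (F : (nat -> R) -> R) (I : Type)
    (r : seq I) (w : I -> R) (h : I -> nat -> R) : expectation F ->
  F (fun x => \sum_(i <- r) w i * h i x) = \sum_(i <- r) w i * F (h i).
Proof.
case=> Flin _ F1.
have F0 : F (fun=> 0) = 0.
  have := Flin (-1) (fun=> 1) (fun=> 1).
  have -> : (fun _ : nat => -1 * 1 + 1 : R) = fun=> 0.
    by apply/funext => x; rewrite mulN1r addNr.
  by move=> ->; rewrite mulN1r addNr.
elim: r => [|i r IHr].
  by rewrite big_nil -[RHS]F0; congr F; apply/funext => x; rewrite big_nil.
rewrite big_cons -IHr -Flin.
by congr F; apply/funext => x; rewrite big_cons.
Qed.

Lemma expectation_scale (R : realType) (F : (nat -> R) -> R) a f :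
  expectation F -> F (fun x => a * f x) = a * F f.
Proof.
move=> EF.
have := @expectation_sum R F unit [:: tt] (fun=> a) (fun=> f) EF.
rewrite big_seq1 => <-; congr F; apply/funext => x; by rewrite big_seq1.
Qed.

Lemma average_expectation (R : realType) (M q : nat) (x : nat) : (0 < q)%N ->
  expectation (fun f : nat -> R => average M q f x).
Proof.
move=> q0; have qR : 0 < q%:R :> R by rewrite ltr0n.
split=> [a f g|f g fg|].
- by rewrite /average big_split /= -mulr_sumr mulrDr mulrCA.
- by rewrite /average ler_wpM2l ?invr_ge0 ?ler0n // ler_sum.
- by rewrite /average sumr_const_nat subn0 mulVf // gt_eqF.
Qed.

(* The density by which the measure of a fibre is multiplied, at a point of B
   (b = true) or outside B, when B has relative density a in the fibre. *)
Definition distortion (R : realType) (a : R) (b : bool) : R :=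
  if a < 2^-1 then (if b then 0 else (1 - a)^-1)
  else (if b then (2 * a - 1) / a else 2).

Lemma distortion_bounds (R : realType) (a : R) b : 0 <= a <= 1 ->
  0 <= distortion a b <= 2.
Proof.
move=> /andP[a0 a1]; rewrite /distortion; case: ltP => a2; case: b.
- by rewrite lexx ler0n.
- have h : 0 < 1 - a by lra.
  rewrite invr_ge0 ltW //= -[2]invrK lef_pV2 ?posrE ?invr_gt0 //; lra.
- have h : 0 < a by lra.
  apply/andP; split; first by rewrite divr_ge0 //; lra.
  by rewrite ler_pdivrMr //; lra.
- by rewrite lexx ler0n.
Qed.

(** Distortion preserves the mass of a fibre. The left side is the mean of an affine function of the
    indicator of B, which has mean a. *)
Lemma distortion_mean (R : realType) (a : R) :
  distortion a false + (distortion a true - distortion a false) * a = 1.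
Proof.
rewrite /distortion; case: ltP => a2.
  have h : 1 - a != 0 by rewrite gt_eqF //; lra.
  by field.
have h : a != 0 by rewrite gt_eqF //; lra.
by field.
Qed.

(** Here the square is gained: B keeps mass 0 when a < 1/2, and otherwise [2a - 1 <= a ^ 2], that is
    [(a - 1) ^ 2 >= 0]. *)
Lemma distortion_true_le (R : realType) (a : R) : distortion a true * a <= a ^+
    2.
Proof.
rewrite /distortion; case: ltP => a2; first by rewrite mul0r sqr_ge0.
have h : a != 0 by rewrite gt_eqF //; lra.
by rewrite divfK //; have := sqr_ge0 (a - 1); rewrite sqrrB; lra.
Qed.

(** One distortion step: functions periodic modulo M keep their expectation because the density has
    mean 1 on each fibre, densities are at most 2, and B is left with at most the second moment of
    its relative density. *)
Lemma expectation_distort (R : realType) (F : (nat -> R) -> R) (M q : nat)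
    (B : pred nat) : (0 < q)%N -> expectation F ->
  exists F' : (nat -> R) -> R,
  [/\ expectation F',
      forall g, (forall x t, g (x + M * t)%N = g x) -> F' g = F g,
      forall f : nat -> R, (forall x, 0 <= f x) -> F' f <= 2 * F (average M q
          f) &
      F' (fun x => (B x)%:R) <=
        F (fun x => average M q (fun y => (B y)%:R) x ^+ 2)].
Proof.
move=> q0 EF; have [Flin Fmono F1] := EF.
pose al := average M q (fun y => (B y)%:R : R).
have al01 x : 0 <= al x <= 1.
  have [Alin Amono A1] := @average_expectation R M q x q0.
  apply/andP; split.
    by rewrite mulr_ge0 ?invr_ge0 // sumr_ge0.
  by rewrite -A1; apply: Amono => y; rewrite lern1 leq_b1.
pose w x y := distortion (al x) (B y).
have mean x : average M q (w x) x = 1.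
  have [Alin _ _] := @average_expectation R M q x q0.
  have Acst c : average M q (fun=> c) x = c :> R.
    by rewrite /average sumr_const_nat subn0 -[c *+ q]mulr_natl mulKf // gt_eqF
        ?ltr0n.
  (* On the fibre the density is affine in the indicator of B, so [distortion_mean] computes its
     mean. *)
  rewrite -(distortion_mean (al x)) addrC.
  rewrite -[X in _ = _ + X]Acst {4}/al -Alin.
  congr (_ * _); apply: eq_bigr => t _.
  by rewrite /w -/(al x); case: (B _) => /=; ring.
exists (fun f => F (fun x => average M q (fun y => w x y * f y) x)); split.
- split=> [a f g|f g fg|].
  + rewrite -Flin; congr F; apply/funext => x.
    have [Alin _ _] := @average_expectation R M q x q0.
    rewrite -Alin; congr (_ * _); apply: eq_bigr => t _; ring.
  + apply: Fmono => x; have [_ Amono _] := @average_expectation R M q x q0.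
    apply: Amono => y; rewrite ler_wpM2l //.
    by have /andP[] := distortion_bounds (B y) (al01 x).
  + rewrite -[RHS]F1; congr F; apply/funext => x; rewrite -[RHS](mean x).
    by congr (_ * _); apply: eq_bigr => t _; rewrite mulr1.
- move=> g hg; congr F; apply/funext => x.
  rewrite -[RHS]mulr1 -(mean x) /average mulrCA; congr (_ * _).
  by rewrite mulr_sumr; apply: eq_bigr => t _; rewrite hg mulrC.
- move=> f f0; rewrite -(expectation_scale _ _ EF); apply: Fmono => x.
  rewrite /average mulrCA [2 * _]mulr_sumr ler_wpM2l ?invr_ge0 // ler_sum // =>
      t _.
  rewrite ler_wpM2r //.
  by have /andP[] := distortion_bounds (B (x + M * t)%N) (al01 x).
- apply: Fmono => x; apply: le_trans (distortion_true_le (al x)).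
  rewrite {2}/al /average mulrCA [distortion _ _ * _]mulr_sumr ler_wpM2l
      ?invr_ge0 // ler_sum //.
  by move=> t _; rewrite /w; case: (B _); rewrite ?mulr0.
Qed.

(** * Congruence classes in fibres *)

Definition in_class (R : realType) (a m x : nat) : R := (x == a %[mod m])%:R.

(** P lies in a single class modulo d, so each of the u blocks of length d meets it at most once. *)
Lemma sum_separated_le (d u : nat) (P : pred nat) :
  (forall i j, P i -> P j -> i = j %[mod d]) ->
  (\sum_(0 <= t < u * d) P t <= u)%N.
Proof.
move=> sep; rewrite big_nat_mul -[leqRHS]muln1 -[u in leqRHS]subn0.
rewrite -sum_nat_const_nat; apply: leq_sum => i _.
have -> : (\sum_(i * d <= j < i.+1 * d) P j =
    count P (index_iota (i * d) (i.+1 * d)))%N.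
  by rewrite -sum1_count [RHS]big_mkcond; apply: eq_bigr => j _; case: (P j).
rewrite -size_filter; set s := [seq _ <- _ | _].
have us : uniq s by rewrite filter_uniq ?iota_uniq.
case sE : s => [//|j0 s']; rewrite -sE -[1%N]/(size [:: j0]).
have P0 : j0 \in s by rewrite sE mem_head.
apply: uniq_leq_size => // j js; rewrite inE.
move: js P0; rewrite !mem_filter !mem_index_iota.
move=> /andP[Pj jd] /andP[P0 j0d]; have := sep _ _ Pj P0.
have mod_sub k : (i * d <= k < i.+1 * d)%N -> (k %% d = k - i * d)%N.
  move=> /andP[k1 k2]; rewrite -{1}(subnKC k1) modnMDl modn_small //.
  by move: k2; rewrite mulSn; lia.
by rewrite !mod_sub // => h; apply/eqP; lia.
Qed.

(** Since M is prime to p, [x + M * t = a] modulo [p ^ k] fixes t modulo [p ^ k]; so at most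
    [p ^ (G - k)] of the [p ^ G] points of the fibre count, and none unless [x = a] modulo m. *)
Lemma average_in_class_le (R : realType) G p M m k a x : prime p ->
  coprime M p -> (m %| M)%N -> (k <= G)%N ->
  average M (p ^ G) (in_class R a (m * p ^ k)) x <=
    p%:R^-1 ^+ k * in_class R a m x.
Proof.
move=> pp cMp mM kG; have p0 : (0 < p)%N by rewrite prime_gt0.
have xM t : (x + M * t == a %[mod m * p ^ k] -> x == a %[mod m])%N.
  move=> /eqP h; have := congr1 (modn^~ m) h.
  rewrite !modn_dvdm ?dvdn_mulr // => <-.
  by rewrite -modnDmr (eqP (dvdn_mulr t mM)) addn0.
rewrite /in_class /average; case xa : (_ == _ %[mod m]); last first.
  rewrite mulr0 big1 ?mulr0 // => t _.
  by case h : (_ == _) => //; rewrite (xM _ h) in xa.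
rewrite mulr1 -natr_sum.
have pG : 0 < (p ^ G)%:R :> R by rewrite ltr0n expn_gt0 p0.
rewrite mulrC ler_pdivrMr //.
have -> : p%:R^-1 ^+ k * (p ^ G)%:R = (p ^ (G - k))%:R :> R.
  rewrite -{1}(subnK kG) expnD natrM mulrCA exprVn natrX [(p ^ k)%:R]natrX.
  by rewrite mulVf ?mulr1 // expf_neq0 // pnatr_eq0 -lt0n.
rewrite ler_nat -{1}(subnK kG) expnD.
apply: (@sum_separated_le _ _
  (fun t => x + M * t == a %[mod m * p ^ k])%N) => i j.
wlog ij : i j / (i <= j)%N => [wl|].
  by case: (leqP i j) => [|/ltnW] ij h1 h2; [exact: wl|apply/esym; exact: wl].
move=> /eqP h1 /eqP h2; apply/esym/eqP; rewrite eqn_mod_dvd //.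
have : (x + M * j == x + M * i %[mod m * p ^ k])%N by rewrite h1 h2.
rewrite eqn_mod_dvd; last by rewrite leq_add2l leq_mul2l ij orbT.
rewrite subnDl -mulnBr => /(dvdn_trans (dvdn_mull m (dvdnn _))).
by rewrite Gauss_dvdr // coprimeXl // coprime_sym.
Qed.

Lemma average_in_class_uniform_le (R : realType) N m a :
  (0 < N)%N -> (m %| N)%N -> average 1 N (in_class R a m) 0 <= m%:R^-1.
Proof.
move=> N0 mN; have m0 := dvdn_gt0 N0 mN.
rewrite /average /in_class mulrC ler_pdivrMr ?ltr0n //.
rewrite -{2}(divnK mN) natrM mulrC mulfK ?pnatr_eq0 -?lt0n // -natr_sum ler_nat.
rewrite -{1}(divnK mN); under eq_bigr do rewrite add0n mul1n.
by apply: sum_separated_le => i j /eqP -> /eqP ->.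
Qed.

Lemma sum_multiplicity_le (R : realType) (s : nat) (ds L : seq nat)
    (g : nat -> R) :
  (forall d, 0 <= g d) -> (forall d, count_mem d ds <= s)%N ->
  {subset ds <= L} -> \sum_(d <- ds) g d <= s%:R * \sum_(d <- L) g d.
Proof.
move=> g0 hs sub.
apply: (@le_trans _ _ (s%:R * \sum_(d <- undup ds) g d)).
  rewrite -big_undup_iterop_count mulr_sumr; apply: ler_sum => d _.
  by rewrite Monoid.iteropE iter_addr_0 -[leLHS]mulr_natl ler_wpM2r ?ler_nat.
rewrite ler_wpM2l //.
have sub' : {subset undup ds <= L} by move=> d; rewrite mem_undup; apply: sub.
elim: (undup ds) (undup_uniq ds) L sub' {sub} => [|d r IHr] /= => [_|/andP[dr
    ur]] L sub.
  by rewrite big_nil sumr_ge0.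
have dL : d \in L by apply: sub; rewrite mem_head.
rewrite big_cons (perm_big _ (perm_to_rem dL)) big_cons lerD2l.
apply: IHr => // e er; apply: rem_mem; first by apply: contraNneq dr => <-.
by apply: sub; rewrite inE er orbT.
Qed.

(** * The sieve over the primes *)

Definition covered (A : seq (nat * nat)) (M : nat) : pred nat :=
  fun x => has (fun c => (c.2 %| M)%N && (x == c.1 %[mod c.2])%N) A.

Lemma has_le_sum (R : realType) (I : Type) (P : pred I) (s : seq I) :
  (has P s)%:R <= \sum_(i <- s) (P i)%:R :> R.
Proof.
elim: s => [|i s IHs]; first by rewrite big_nil.
rewrite big_cons /=; case: (P i) => /=; last by rewrite add0r.
by rewrite lerDl sumr_ge0.
Qed.

Lemma sum_geometric_le (R : realType) (x : R) G : 0 <= x <= 2^-1 ->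
  \sum_(1 <= k < G.+1) x ^+ k <= 2 * x.
Proof.
move=> /andP[x0 x2]; apply: (@le_trans _ _ (2 * x - 2 * x ^+ G.+1)); last first.
  by rewrite lerBlDr lerDl mulr_ge0 ?exprn_ge0.
elim: G => [|G IHG]; first by rewrite big_geq // expr1 subrr.
rewrite big_nat_recr //= (exprSr x G.+1).
have : 0 <= x ^+ G.+1 * (2^-1 - x) by rewrite mulr_ge0 ?exprn_ge0 ?subr_ge0.
by move: IHG; set y := x ^+ G.+1; set z := \sum_(_ <= _ < _) _; lra.
Qed.

(** Two classes with a common point b meet in the class of b modulo the lcm. *)
Lemma expectation_in_classM (R : realType) (F : (nat -> R) -> R) M m1 m2 a1 a2 :
  expectation F ->
  (forall m a, (m %| M)%N -> F (in_class R a m) <= class_weight R m) ->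
  (m1 %| M)%N -> (m2 %| M)%N ->
  F (fun x => in_class R a1 m1 x * in_class R a2 m2 x) <=
    class_weight R (lcmn m1 m2).
Proof.
move=> [_ Fmono _] Fcls m1M m2M.
have lM : (lcmn m1 m2 %| M)%N by rewrite dvdn_lcm m1M.
case: (pselect (exists b, (b == a1 %[mod m1]) && (b == a2 %[mod m2]))%N).
  case=> b /andP[/eqP b1 /eqP b2]; apply: le_trans (Fcls _ b lM).
  apply: Fmono => x; rewrite /in_class -natrM ler_nat.
  case h1 : (_ == _); last by rewrite mul0n.
  case h2 : (_ == _); last by rewrite muln0.
  move: h1 h2; rewrite -b1 -b2 => h1 h2; suff -> : (x == b %[mod lcmn m1 m2])%N
      by [].
  wlog xb : x b h1 h2 {b1 b2} / (x <= b)%N => [wl|].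
    case: (leqP x b) => [|/ltnW]; first exact: wl.
    by move=> ?; rewrite eq_sym wl // eq_sym.
  by rewrite eq_sym eqn_mod_dvd // dvdn_lcm -!eqn_mod_dvd // ![(b == _ %[mod
      _])%N]eq_sym h1.
(* For disjoint classes the product vanishes, so any class modulo the lcm dominates it; that of 0 is
   picked. *)
move=> nb; apply: le_trans (Fcls _ 0%N lM); apply: Fmono => x.
rewrite /in_class -natrM ler_nat.
case h1 : (x == a1 %[mod m1])%N; last by rewrite mul0n.
case h2 : (x == a2 %[mod m2])%N; last by rewrite muln0.
by case: nb; exists x; rewrite h1 h2.
Qed.

(** The invariant carried from prime to prime. The class bound is kept because the next distortion
    needs it to estimate a second moment. *)
Definition sieved (R : realType) (G : nat) (A : seq (nat * nat)) (n : nat)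
    (eta : R) : Prop :=
  exists F : (nat -> R) -> R,
  [/\ expectation F,
      forall m a, (m %| smooth_mod G n)%N ->
        F (in_class R a m) <= class_weight R m &
      F (fun x => (covered A (smooth_mod G n) x)%:R) <= eta].

(** Union bound for the uniform measure modulo [smooth_mod G n]: a class modulo m has mass at most
    [1 / m], which is at most its weight. *)
Lemma sieved_uniform (R : realType) (G : nat) (A : seq (nat * nat)) (s D n :
    nat) :
  (forall d, count_mem d (unzip2 A) <= s)%N -> (forall d, d \in unzip2 A -> D
      <= d)%N ->
  sieved G A n (s%:R * \sum_(d <- smooth_seq G n | (D <= d)%N) d%:R^-1 : R).
Proof.
move=> hs hD; set M := smooth_mod G n; have M0 : (0 < M)%N by exact:
    smooth_mod_gt0.
have EF := @average_expectation R 1 M 0 M0.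
exists (fun f => average 1 M f 0); split => //.
  move=> m a mM; apply: le_trans (class_weight_ge_inv _ _).
  exact: average_in_class_uniform_le.
have [_ Fmono _] := EF.
pose A' := [seq c <- A | (c.2 %| M)%N].
apply: (@le_trans _ _ (\sum_(c <- A') c.2%:R^-1)).
  apply: (@le_trans _ _ (average 1 M (fun x => \sum_(c <- A') 1 * in_class R
      c.1 c.2 x) 0)).
    apply: Fmono => x; rewrite /A' big_filter big_mkcond /=.
    apply: le_trans (has_le_sum _ _ _) _; apply: ler_sum => c _.
    by rewrite mul1r; case: ifP.
  rewrite (expectation_sum _ _ _ EF) big_seq [leRHS]big_seq; apply: ler_sum =>
      c.
  rewrite mem_filter mul1r => /andP[cM _].
  exact: average_in_class_uniform_le.
rewrite [X in _ * X]big_mkcond /=.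
pose g d : R := if (D <= d)%N then d%:R^-1 else 0.
apply: (@le_trans _ _ (\sum_(d <- unzip2 A') g d)).
  rewrite big_map big_seq [leRHS]big_seq; apply: ler_sum => c.
  rewrite mem_filter /g => /andP[_ cA].
  by rewrite hD // map_f.
apply: sum_multiplicity_le.
- by move=> d; rewrite /g; case: ifP => // _; rewrite invr_ge0.
- move=> d; apply: leq_trans (hs d).
  by rewrite /unzip2 !count_map /A' count_filter sub_count // => c /= /andP[].
- move=> d /mapP[c]; rewrite mem_filter => /andP[cM _] ->.
  exact: mem_smooth_seq.
Qed.

Lemma logn_mul_pfactor p m k : (0 < m)%N -> prime p -> coprime m p ->
  logn p (m * p ^ k) = k.
Proof. by move=> m0 pp cmp; rewrite logn_Gauss ?pfactorK // coprime_sym. Qed.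

(** The left side equals [S ^+ 2 * pair_sum R G p]: the exponents of p separate from the p-free
    parts, and the geometric sum S is at most [2 / p]. *)
Lemma sum_new_moduli_le (R : realType) G p : prime p ->
  \sum_(d1 <- [seq (m * p ^ k)%N | m <- smooth_seq G p, k <- index_iota 1 G.+1])
  \sum_(d2 <- [seq (m * p ^ k)%N | m <- smooth_seq G p, k <- index_iota 1 G.+1])
    p%:R^-1 ^+ logn p d1 * (p%:R^-1 ^+ logn p d2 *
      class_weight R (lcmn (d1 %/ p ^ logn p d1) (d2 %/ p ^ logn p d2)))
  <= (2 / p%:R) ^+ 2 * pair_sum R G p.
Proof.
move=> pp; set x := p%:R^-1; set S := \sum_(1 <= k < G.+1) x ^+ k.
have x0 : 0 <= x by rewrite invr_ge0.
have x2 : x <= 2^-1.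
  by rewrite lef_pV2 ?posrE ?ltr0n ?prime_gt0 // ler_nat prime_gt1.
have S2 : S <= 2 * x by apply: sum_geometric_le; rewrite x0.
have S0 : 0 <= S by rewrite sumr_ge0 // => k _; rewrite exprn_ge0.
apply: (@le_trans _ _ (S ^+ 2 * pair_sum R G p)); last first.
  by rewrite ler_wpM2r ?pair_sum_ge0 // lerXn2r // nnegrE mulr_ge0.
have quo m k : m \in smooth_seq G p ->
    logn p (m * p ^ k) = k /\ (m * p ^ k %/ p ^ k = m)%N.
  move=> mL; split; last by rewrite mulnK // expn_gt0 prime_gt0.
  apply: logn_mul_pfactor => //; first exact: smooth_seq_gt0 mL.
  exact: smooth_seq_coprime mL.
rewrite le_eqVlt; apply/orP; left; apply/eqP.
rewrite big_allpairs_dep /pair_sum mulr_sumr; apply: eq_big_seq => m1 m1L.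
transitivity (\sum_(1 <= k < G.+1)
    x ^+ k * (S * \sum_(m2 <- smooth_seq G p) class_weight R (lcmn m1 m2))).
  apply: eq_bigr => k1 _; have [-> ->] := quo m1 k1 m1L.
  rewrite big_allpairs_dep !mulr_sumr; apply: eq_big_seq => m2 m2L.
  rewrite mulr_suml mulr_sumr; apply: eq_bigr => k2 _.
  by have [-> ->] := quo m2 k2 m2L.
by rewrite -mulr_suml mulrA -expr2.
Qed.

(** For p prime, the classes whose modulus becomes admissible form B. The earlier ones are periodic
    modulo M, so distortion leaves their mass alone; B costs the second moment of its density,
    bounded by expanding a square over pairs of new classes. *)
Lemma sieved_step (R : realType) (G : nat) (A : seq (nat * nat)) (s p : nat)
    (eta : R) :
  (forall d, count_mem d (unzip2 A) <= s)%N ->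
  sieved G A p eta ->
  sieved G A p.+1 (eta + s%:R ^+ 2 * ((2 / p%:R) ^+ 2 * pair_sum R G p)).
Proof.
move=> hs [F [EF Fcls Fcov]].
have inc0 : 0 <= s%:R ^+ 2 * ((2 / p%:R) ^+ 2 * pair_sum R G p).
  by rewrite !mulr_ge0 ?exprn_ge0 ?pair_sum_ge0 // divr_ge0.
rewrite /sieved [smooth_mod _ _]/= -/smooth_mod; case: ifP => pp; last first.
  by exists F; split => //; apply: le_trans Fcov _; rewrite lerDl.
set M := smooth_mod G p in Fcls Fcov *; set q := (p ^ G)%N.
have M0 : (0 < M)%N by exact: smooth_mod_gt0.
have q0 : (0 < q)%N by rewrite expn_gt0 prime_gt0.
have cMp : coprime M p by exact: coprime_smooth_mod.
pose A' := [seq c <- A | (c.2 %| M * q)%N && ~~ (c.2 %| M)%N].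
pose B x := has (fun c => x == c.1 %[mod c.2])%N A'.
have [F' [EF' F'per F'le F'B]] := expectation_distort M B q0 EF.
have [_ Fmono _] := EF; have [F'lin F'mono _] := EF'.
have per a m x t : (m %| M)%N -> (x + M * t == a %[mod m])%N = (x == a %[mod
    m])%N.
  by move=> mM; rewrite -modnDmr (eqP (dvdn_mulr t mM)) addn0.
have split_dvd d : (d %| M * q)%N ->
    exists m k, [/\ (m %| M)%N, (k <= G)%N & d = (m * p ^ k)%N].
  exact: dvd_mul_pfactor.
have gt0M m : (m %| M)%N -> (0 < m)%N by exact: dvdn_gt0.
have copM m : (m %| M)%N -> coprime m p by move=> mM; apply: coprime_dvdl mM
    cMp.
exists F'; split => //.
  (* If [k = 0] the class is periodic modulo M and keeps its mass; otherwise the fibre mean gives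
     [1 / p ^ k] and distortion at most doubles it. *)
  move=> d a /split_dvd[m [k [mM kG ->]]].
  rewrite class_weight_pfactor ?gt0M ?copM //; case: k kG => [|k] kG.
    rewrite muln1 mulr1 F'per; first exact: Fcls.
    by move=> x t; rewrite /in_class per.
  apply: le_trans (F'le _ _) _; first by move=> x; rewrite ler0n.
  rewrite /= [class_weight _ _ * _]mulrC -mulrA ler_wpM2l //.
  apply: (@le_trans _ _ (F (fun x => p%:R^-1 ^+ k.+1 * in_class R a m x))).
    by apply: Fmono => x; apply: average_in_class_le.
  by rewrite (expectation_scale _ _ EF) exprVn ler_wpM2l ?invr_ge0 ?exprn_ge0
      ?Fcls.
have covB x : (covered A (M * q) x)%:R <=
    1 * (covered A M x)%:R + (B x)%:R :> R.
  rewrite mul1r -natrD ler_nat /covered.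
  case: hasP => [[c cA /andP[cMq cx]]|//].
  have [cM|ncM] := boolP (c.2 %| M)%N.
    by rewrite (_ : has _ A) //; apply/hasP; exists c => //; rewrite cM.
  rewrite (_ : B x) ?leq_addl //; apply/hasP; exists c => //.
  by rewrite mem_filter ncM cMq.
apply: le_trans (F'mono _ _ covB) _; rewrite F'lin mul1r; apply: lerD.
  rewrite F'per // => x t; congr (nat_of_bool _)%:R; apply: eq_has => c.
  by case cM : (c.2 %| M)%N => //=; rewrite per.
apply: le_trans F'B _.
pose m_ d := (d %/ p ^ logn p d)%N.
have A'P c : c \in A' -> exists m k, [/\ (m %| M)%N, (0 < k <= G)%N,
    c.2 = (m * p ^ k)%N, logn p c.2 = k & m_ c.2 = m].
  rewrite mem_filter => /andP[/andP[/split_dvd[m [k [mM kG cE]]] ncM] _].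
  have lE : logn p c.2 = k by rewrite cE logn_mul_pfactor ?gt0M ?copM.
  exists m, k; split => //.
    rewrite kG andbT lt0n; apply: contraNneq ncM => k0.
    by rewrite cE k0 muln1.
  by rewrite /m_ lE cE mulnK // expn_gt0 prime_gt0.
pose T x := \sum_(c <- A') p%:R^-1 ^+ logn p c.2 * in_class R c.1 (m_ c.2) x.
have alT x : average M q (fun y => (B y)%:R) x <= T x.
  have EA := @average_expectation R M q x q0; have [_ Amono _] := EA.
  apply: (@le_trans _ _ (average M q
      (fun y => \sum_(c <- A') 1 * in_class R c.1 c.2 y) x)).
    apply: Amono => y; apply: le_trans (has_le_sum _ _ _) _.
    by apply: ler_sum => c _; rewrite mul1r.
  rewrite (expectation_sum _ _ _ EA) /T big_seq [leRHS]big_seq; apply: ler_sum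
      => c.
  move=> /A'P[m [k [mM /andP[_ kG] cE -> ->]]]; rewrite mul1r cE.
  exact: average_in_class_le.
(* The square of T becomes a double sum, in which the expectation of each product of two indicators
   is bounded by the weight of an lcm. *)
apply: (@le_trans _ _ (F (fun x => \sum_(c1 <- A') p%:R^-1 ^+ logn p c1.2 *
    (in_class R c1.1 (m_ c1.2) x * T x)))).
  apply: Fmono => x; under eq_bigr do rewrite mulrA.
  rewrite -mulr_suml -/(T x) -expr2 lerXn2r // nnegrE.
    by rewrite mulr_ge0 ?invr_ge0 // sumr_ge0.
  by rewrite sumr_ge0 // => c _; rewrite mulr_ge0 ?exprn_ge0 ?invr_ge0 ?ler0n.
rewrite (expectation_sum _ _ _ EF).
pose g d1 d2 : R := p%:R^-1 ^+ logn p d1 * (p%:R^-1 ^+ logn p d2 *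
  class_weight R (lcmn (m_ d1) (m_ d2))).
apply: (@le_trans _ _ (\sum_(d1 <- unzip2 A') \sum_(d2 <- unzip2 A') g d1 d2)).
  rewrite big_map big_seq [leRHS]big_seq; apply: ler_sum => c1 c1A.
  have [m1 [k1 [m1M _ _ _ m1E]]] := A'P _ c1A.
  rewrite big_map -mulr_sumr ler_wpM2l ?exprn_ge0 ?invr_ge0 ?ler0n //.
  rewrite (_ : (fun x => _) = (fun x => \sum_(c2 <- A') p%:R^-1 ^+ logn p c2.2 *
    (in_class R c1.1 (m_ c1.2) x * in_class R c2.1 (m_ c2.2) x))); last first.
    apply/funext => x; rewrite /T mulr_sumr; apply: eq_bigr => c2 _.
    by rewrite mulrCA.
  rewrite (expectation_sum _ _ _ EF) big_seq [leRHS]big_seq; apply: ler_sum =>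
      c2 c2A.
  have [m2 [k2 [m2M _ _ _ m2E]]] := A'P _ c2A.
  rewrite ler_wpM2l ?exprn_ge0 ?invr_ge0 ?ler0n //.
  by apply: (expectation_in_classM _ _ EF Fcls); rewrite ?m1E ?m2E.
have g0 d1 d2 : 0 <= g d1 d2.
  by rewrite !mulr_ge0 ?exprn_ge0 ?invr_ge0 ?ler0n // class_weight_ge0.
have hs' d : (count_mem d (unzip2 A') <= s)%N.
  apply: leq_trans (hs d).
  by rewrite /unzip2 !count_map /A' count_filter sub_count // => c /= /andP[].
pose PL := [seq (m * p ^ k)%N | m <- smooth_seq G p, k <- index_iota 1 G.+1].
have subPL : {subset unzip2 A' <= PL}.
  move=> d /mapP[c /A'P[m [k [mM kG cE _ _]]] ->]; rewrite cE.
  by apply: allpairs_f; rewrite ?mem_index_iota //; apply: mem_smooth_seq.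
(* The multiplicity is used once per index of the double sum, whence the factor [s ^ 2]. *)
apply: (@le_trans _ _ (s%:R * \sum_(d1 <- PL) \sum_(d2 <- unzip2 A') g d1 d2)).
  by apply: sum_multiplicity_le => // d; rewrite sumr_ge0.
rewrite expr2 -mulrA ler_wpM2l //.
apply: le_trans (ler_wpM2l (ler0n _ s) (sum_new_moduli_le R G pp)).
rewrite mulr_sumr; apply: ler_sum => d1 _.
exact: sum_multiplicity_le.
Qed.

(** * Quantitative bounds *)

Lemma sieved_le (R : realType) G A n (eta eta' : R) :
  eta <= eta' -> sieved G A n eta -> sieved G A n eta'.
Proof.
by move=> le_eta [F [EF Fcls Fcov]]; exists F; split=> //; apply: le_trans
    le_eta.
Qed.

(** The pair sum is at most [e ^ 60 (k + 1) ^ 40], polynomial in k. A ratio below 2 is what keeps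
    the sum against [1 / p ^ 2] over dyadic blocks convergent; 3/2 is taken. *)
Lemma pair_sum_le_geometric (R : realType) : exists2 C : R, 1 <= C &
  forall G k n, (n <= 2 ^ k.+1)%N -> pair_sum R G n <= C * (3 / 2) ^+ k.
Proof.
have l32 : 0 < ln (3 / 2) :> R by rewrite ln_gt0 //; lra.
(* Chosen so that [40 e (k + 1) = (k + 1) ln (3 / 2)]; then [ln z <= z] at [z = e (k + 1)] absorbs
   the power. *)
pose e : R := ln (3 / 2) / 40; have e0 : 0 < e by rewrite divr_gt0.
(* The summand 1 ensures [1 <= C], so that later [64 * C] is at most its positive powers. *)
exists (1 + expR (60 - 40 * ln e) * (3 / 2)).
  by rewrite lerDl mulr_ge0 ?expR_ge0 //; lra.
move=> G k n nk; apply: (@le_trans _ _ (expR (60 - 40 * ln e) * (3 / 2) * (3 /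
    2) ^+ k));
  last first.
  by rewrite ler_wpM2r ?exprn_ge0 ?lerDr //; lra.
have -> : expR (60 - 40 * ln e) * (3 / 2) * (3 / 2) ^+ k =
    expR (60 - 40 * ln e + k.+1%:R * ln (3 / 2)).
  rewrite [RHS]expRD expRM_natl lnK ?posrE; last by lra.
  by rewrite exprS mulrA.
apply: le_trans (pair_sum_le R G n) _; rewrite ler_expR.
have h1 := prime_recip_sum_mono R nk.
have h2 := @prime_recip_sum_le R k.+1 isT.
have k0 : 0 < k.+1%:R :> R by rewrite ltr0n.
have h3 : ln k.+1%:R <= e * k.+1%:R - ln e :> R.
  rewrite lerBrDl -lnM ?posrE //; apply/ltW/ln_sublinear.
  by rewrite mulr_gt0.
have h4 : 40 * (e * k.+1%:R) = k.+1%:R * ln (3 / 2) by rewrite /e; field.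
move: h1 h2 h3 h4; set u := ln k.+1%:R; set v := prime_recip_sum R n.
set w := prime_recip_sum R _; set z := e * _; set y := k.+1%:R * _; lra.
Qed.

Lemma sieved_dyadic (R : realType) G A s k (eta C : R) : 0 <= C ->
  (forall n, (n <= 2 ^ k.+1)%N -> pair_sum R G n <= C * (3 / 2) ^+ k) ->
  (forall d, count_mem d (unzip2 A) <= s)%N ->
  sieved G A (2 ^ k) eta ->
  sieved G A (2 ^ k.+1) (eta + 4 * s%:R ^+ 2 * C * (3 / 4) ^+ k).
Proof.
move=> C0 hC hs h0; pose b : R := 4 * s%:R ^+ 2 * C * (3 / 8) ^+ k.
(* b bounds the increment at one n of the block: [4 / 4 ^ k] for [(2 / n) ^ 2], times
   [C (3 / 2) ^ k] for the pair sum. The [2 ^ k] steps turn 3/8 into 3/4. *)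
have b0 : 0 <= b by rewrite !mulr_ge0 ?exprn_ge0 //; lra.
have main i : (i <= 2 ^ k)%N -> sieved G A (2 ^ k + i) (eta + i%:R * b).
  elim: i => [|i IHi] ik; first by rewrite addn0 mul0r addr0.
  rewrite addnS; apply: sieved_le (sieved_step hs (IHi (ltnW ik))).
  rewrite -[i.+1%:R]natr1 (mulrDl i%:R) mul1r addrA lerD2l.
  have hp : pair_sum R G (2 ^ k + i) <= C * (3 / 2) ^+ k.
    by apply: hC; rewrite expnS; lia.
  have n0 : 0 < (2 ^ k)%:R :> R by rewrite ltr0n expn_gt0.
  have hq : (2 / (2 ^ k + i)%:R) ^+ 2 <= 4 * (4^-1) ^+ k :> R.
    have -> : 4 * (4^-1) ^+ k = (2 / (2 ^ k)%:R) ^+ 2 :> R.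
      rewrite expr_div_n natrX -exprM mulnC exprM exprVn; congr (_ / _ ^+ _).
        by rewrite expr2; lra.
      by rewrite expr2; lra.
    rewrite lerXn2r ?nnegrE ?divr_ge0 // ler_wpM2l //.
    by rewrite lef_pV2 ?posrE ?ler_nat ?leq_addr // ltr0n addn_gt0 expn_gt0.
  apply: (@le_trans _ _ (s%:R ^+ 2 * (4 * (4^-1) ^+ k * (C * (3 / 2) ^+ k)))).
    by rewrite ler_wpM2l ?exprn_ge0 // ler_pM ?pair_sum_ge0 // exprn_ge0 //
        divr_ge0.
  have -> : b = s%:R ^+ 2 * (4 * (4^-1 * (3 / 2)) ^+ k * C).
    rewrite /b (_ : 4^-1 * (3 / 2) = 3 / 8); last by field.
    by set u := _ ^+ k; ring.
  by rewrite [(4^-1 * _) ^+ k]exprMn; set u := _ ^+ k; set v := _ ^+ k; lra.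
have := main _ (leqnn _); rewrite addnn -mul2n -expnS.
have -> : (2 ^ k)%:R * b = 4 * s%:R ^+ 2 * C * (3 / 4) ^+ k.
  rewrite /b (_ : 3 / 4 = 2 * (3 / 8) :> R); last by field.
  by rewrite [(2 * _) ^+ k]exprMn natrX; set u := _ ^+ k; set v := _ ^+ k; ring.
by [].
Qed.

Lemma sieved_tail (R : realType) G A s K j (eta C : R) : 0 <= C ->
  (forall k n, (n <= 2 ^ k.+1)%N -> pair_sum R G n <= C * (3 / 2) ^+ k) ->
  (forall d, count_mem d (unzip2 A) <= s)%N ->
  sieved G A (2 ^ K) eta ->
  sieved G A (2 ^ (K + j)) (eta + 16 * s%:R ^+ 2 * C * (3 / 4) ^+ K).
Proof.
move=> C0 hC hs h0; set B := 16 * s%:R ^+ 2 * C.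
have B0 : 0 <= B by rewrite !mulr_ge0 ?exprn_ge0.
(* A telescoped geometric series, with [16 = 4 / (1 - 3 / 4)]. *)
apply: (@sieved_le _ _ _ _ (eta + B * ((3 / 4) ^+ K - (3 / 4) ^+ (K + j)))).
  by rewrite lerD2l ler_wpM2l // lerBlDr lerDl exprn_ge0 //; lra.
elim: j => [|j IHj]; first by rewrite addn0 subrr mulr0 addr0.
rewrite addnS; apply: sieved_le (sieved_dyadic C0 (hC _) hs IHj).
rewrite -addrA lerD2l (exprS (3 / 4) (K + j)) /B; set y := _ ^+ (K + j); set z
    := _ ^+ K.
by rewrite le_eqVlt; apply/orP; left; apply/eqP; field.
Qed.

(** * Smooth moduli and Rankin's trick *)

Lemma sum_geometric_le_expR (R : realType) (x : R) G : 0 <= x <= 3 / 4 ->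
  \sum_(0 <= k < G) x ^+ k <= expR (4 * x).
Proof.
move=> /andP[x0 x34]; apply: le_trans (expR_ge1Dx _).
apply: (@le_trans _ _ ((1 - x)^-1)).
  rewrite -[leRHS]mul1r ler_pdivlMr; last by lra.
  rewrite big_mkord mulrC -[1 - x]opprB mulNr -subrX1 opprB lerBlDr lerDl.
  exact: exprn_ge0.
(* Clearing the denominator leaves [(1 + 4x) (1 - x) - 1 = 4x (3/4 - x)]. *)
rewrite -[leLHS]mul1r ler_pdivrMr; last by lra.
have : 0 <= x * (3 / 4 - x) by rewrite mulr_ge0 //; lra.
lra.
Qed.

Lemma ln_prime_ge (R : realType) p : prime p -> ln 2 <= ln p%:R :> R.
Proof.
by move=> pp; rewrite ler_ln ?posrE ?ltr0n ?prime_gt0 // ler_nat prime_gt1.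
Qed.

(* Rankin's trick: 1/d is bounded by D^-sigma d^(sigma - 1) for d >= D, where
   sigma is chosen so that y^sigma = K^(1/2) for y = 2^K. *)
Lemma sum_smooth_recip_le (R : realType) G K D : (1 < K)%N -> (0 < D)%N ->
  \sum_(d <- smooth_seq G (2 ^ K) | (D <= d)%N) d%:R^-1 <=
  expR (28 * K%:R - ln K%:R / (2 * K%:R * ln 2) * ln D%:R) :> R.
Proof.
move=> K1 D0; set sg := ln K%:R / (2 * K%:R * ln 2).
have l2 : 0 < ln 2 :> R by rewrite ln_gt0 // ltr1n.
have K0 : 0 < K%:R :> R by rewrite ltr0n; lia.
have lK0 : 0 <= ln K%:R :> R by rewrite ln_ge0 // ler1n; lia.
have sg0 : 0 <= sg by rewrite divr_ge0 // !mulr_ge0 // ltW.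
have sg2 : sg <= 2^-1.
  rewrite ler_pdivrMr ?mulr_gt0 // !mulrA mulVf // mul1r mulr_natl.
  by rewrite -lnXn // ler_ln ?posrE ?exprn_gt0 // -natrX ler_nat ltnW //
      ltn_expl.
pose f (m : nat) : R := expR (- (1 - sg) * ln m%:R).
apply: (@le_trans _ _
    (expR (- sg * ln D%:R) * \sum_(d <- smooth_seq G (2 ^ K)) f d)).
  rewrite mulr_sumr big_mkcond big_seq [leRHS]big_seq; apply: ler_sum => d dL.
  have d0 : 0 < d%:R :> R by rewrite ltr0n; apply: smooth_seq_gt0 dL.
  case: ifP => Dd; last by rewrite mulr_ge0 ?expR_ge0.
  rewrite -expRD -[d%:R^-1]lnK ?posrE ?invr_gt0 // ler_expR lnV ?posrE //.
  have : ln D%:R <= ln d%:R :> R by rewrite ler_ln ?posrE ?ltr0n ?ler_nat //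
      (leq_trans D0).
  set u := ln D%:R; set v := ln d%:R => uv.
  have : 0 <= sg * (v - u) by rewrite mulr_ge0 // subr_ge0.
  lra.
rewrite (addrC (28 * _)) -[- (sg * _)]mulNr [leRHS]expRD ler_wpM2l ?expR_ge0 //.
pose b p : R := 4 * f p.
apply: (le_trans (@sum_smooth_seq_le R G (2 ^ K) f b _ _)).
- by rewrite /f ln1 mulr0 expR0.
- move=> m p pp m0 cmp; have p0 : 0 < p%:R :> R by rewrite ltr0n prime_gt0.
  under eq_bigr => k _.
    rewrite (_ : f _ = f m * f p ^+ k); last first.
      rewrite /f natrM natrX lnM ?posrE ?exprn_gt0 ?(ltr0n _ m) // lnXn //.
      by rewrite -[ln p%:R *+ k]mulr_natl mulrDr expRD mulrCA expRM_natl.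
    over.
  rewrite -mulr_sumr ler_wpM2l ?expR_ge0 //; apply: sum_geometric_le_expR.
  (* [f p <= p ^ (-1/2)] since [sg <= 1/2], and [1/2 < (3/4) ^ 2]. *)
  rewrite expR_ge0 /=; have h : f p ^+ 2 <= 2^-1.
    rewrite -expRM_natl -[2^-1]lnK ?posrE ?invr_gt0 // ler_expR lnV ?posrE //.
    have h1 := @ln_prime_ge R p pp.
    have : 0 <= (2^-1 - sg) * ln p%:R.
      by apply: mulr_ge0; [rewrite subr_ge0 | apply: le_trans h1; apply: ltW].
    lra.
  rewrite -(@ler_pXn2r _ 2) ?nnegrE ?expR_ge0 //; lra.
rewrite ler_expR; pose r : R := expR (2^-1 * ln K%:R).
have r2 : r ^+ 2 = K%:R.
  by rewrite -expRM_natl mulrA mulfV ?mul1r ?lnK ?posrE // pnatr_eq0.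
have r1 : 1 <= r by rewrite -expR0 ler_expR mulr_ge0.
(* r is the square root of K. For [p < 2 ^ K] the choice of [sg] gives [p ^ sg <= r], so
   [f p <= r / p]. *)
apply: (@le_trans _ _ (4 * r * prime_recip_sum R (2 ^ K))).
  rewrite mulr_sumr big_seq_cond [leRHS]big_seq_cond; apply: ler_sum => p.
  rewrite mem_index_iota => /andP[/andP[_ pK] pp].
  have p0 : 0 < p%:R :> R by rewrite ltr0n prime_gt0.
  rewrite /b -mulrA ler_wpM2l // /r -[p%:R^-1]lnK ?posrE ?invr_gt0 // -expRD.
  rewrite ler_expR lnV ?posrE //.
  have : sg * ln p%:R <= 2^-1 * ln K%:R.
    have -> : 2^-1 * ln K%:R = sg * (K%:R * ln 2).
      by rewrite /sg; field; rewrite !gt_eqF.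
    rewrite ler_wpM2l // mulr_natl -lnXn // ler_ln ?posrE ?exprn_gt0 //.
    by rewrite -natrX ler_nat ltnW.
  lra.
have h := @prime_recip_sum_le R K (ltnW K1).
have lr : ln K%:R <= 2 * r.
  rewrite -r2 lnXn ?(lt_le_trans ltr01) // -[_ *+ 2]mulr_natl ler_wpM2l //.
  by apply/ltW/ln_sublinear; apply: lt_le_trans r1.
(* As [r >= 1], this is at most [28 r ^ 2 = 28 K]. *)
apply: (@le_trans _ _ (4 * r * (3 + 4 * r))).
  rewrite ler_wpM2l ?mulr_ge0 ?(le_trans _ r1) //; lra.
rewrite -r2; have : 0 <= r * (r - 1) by rewrite mulr_ge0 ?subr_ge0 // (le_trans
    _ r1).
by rewrite expr2; lra.
Qed.

(** * Choice of the parameters *)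

Lemma ln_ln3_gt0 (R : realType) : 0 < ln (ln 3) :> R.
Proof.
(* The claim amounts to e < 3, which follows from [e <= (6 / 5) ^ 6 < 3]. *)
have h : expR (6^-1) <= 6 / 5 :> R.
  have h1 : 5 / 6 <= expR (- 6^-1) :> R.
    by apply: le_trans (expR_ge1Dx _); lra.
  rewrite -[expR _]invrK -expRN (_ : 6 / 5 = (5 / 6)^-1); last by field.
  by rewrite lef_pV2 ?posrE ?expR_gt0 //; lra.
rewrite ln_gt0 // -ltr_expR lnK ?posrE ?ltr0n //.
rewrite (_ : expR 1 = expR (6^-1) ^+ 6); last first.
  by rewrite -expRM_natl mulfV // pnatr_eq0.
apply: (@le_lt_trans _ _ ((6 / 5) ^+ 6)).
  by rewrite lerXn2r ?nnegrE ?expR_ge0 //; lra.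
by rewrite !exprS expr0; lra.
Qed.

Lemma ex_geometric_lt (R : realType) (B : R) : 0 < B ->
  exists2 n : nat, (1 < n)%N & B * (3 / 4) ^+ n <= 1.
Proof.
(* Bernoulli gives [(4/3) ^ n >= 1 + n / 3], so [n >= 4 B] suffices; the two successors also give
   [1 < n]. *)
move=> B0; pose n := (Num.truncn (4 * B)).+2; exists n => //.
have hn : 4 * B <= n%:R.
  apply: (le_trans (ltW (truncnS_gt _))); by rewrite ler_nat.
have bern k : 1 + k%:R / 3 <= (4 / 3) ^+ k :> R.
  elim: k => [|k IHk]; first by rewrite mul0r addr0 expr0.
  rewrite (exprS (4 / 3)) -[k.+1%:R]natr1.
  have k0 : 0 <= k%:R :> R by [].
  by apply: (@le_trans _ _ (4 / 3 * (1 + k%:R / 3))); [lra | rewrite ler_wpM2l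
      //; lra].
have -> : 3 / 4 = (4 / 3)^-1 :> R by field.
rewrite exprVn ler_pdivrMr ?exprn_gt0 ?mul1r //; first by have := bern n; lra.
Qed.

(** The witness is the binary logarithm of [s + 1] rounded up, an integer comparable to
    [ln (s + 1)]. *)
Lemma ex_dyadic_scale (R : realType) (s : nat) : (0 < s)%N ->
  exists l : nat, [/\ (0 < l)%N, s%:R <= 2 ^+ l :> R,
    l%:R * ln 2 <= 2 * ln (s + 1)%:R :> R & ln (s + 2)%:R <= (2 * l)%:R :> R].
Proof.
move=> s0; pose l := up_log 2 (s + 1).
have /andP[l_lb l_ub] : (2 ^ l.-1 < s + 1 <= 2 ^ l)%N.
  by apply: up_log_bounds; lia.
have l0 : (0 < l)%N by case: l l_ub {l_lb} => //; lia.
have s2l : (s + 2 <= 2 ^ l.+1)%N by rewrite expnS; lia.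
have s1 : (2 <= s + 1)%N by lia.
have [p1 p2] : (0 < s + 1)%N /\ (0 < s + 2)%N by lia.
have l2 : (l.+1 <= 2 * l)%N by lia.
have sl : (s <= 2 ^ l)%N by lia.
exists l; split => //; first by rewrite -natrX ler_nat.
  have h1 : l.-1%:R * ln 2 <= ln (s + 1)%:R :> R.
    rewrite mulr_natl -lnXn // ler_ln ?posrE ?exprn_gt0 ?ltr0n //.
    by rewrite -natrX ler_nat ltnW.
  have h2 : ln 2 <= ln (s + 1)%:R :> R.
    by rewrite ler_ln ?posrE ?ltr0n ?ler_nat.
  by rewrite -(prednK l0) -[_.+1%:R]natr1; lra.
apply: (@le_trans _ _ (l.+1%:R * ln 2)).
  rewrite mulr_natl -lnXn // ler_ln ?posrE ?exprn_gt0 ?ltr0n //.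
  by rewrite -natrX ler_nat.
have ln21 : ln 2 <= 1 :> R by rewrite (_ : 2 = 1 + 1) ?le_ln1Dx //; lra.
by apply: (@le_trans _ _ l.+1%:R); [rewrite ler_piMr | rewrite ler_nat].
Qed.

Lemma min_modulus_le (R : realType) : exists2 c : R, 0 < c &
  forall (A : seq (nat * nat)) (s D : nat), (0 < s)%N ->
    (forall d, count_mem d (unzip2 A) <= s)%N ->
    (forall d, d \in unzip2 A -> (0 < d)%N && (D <= d)%N) ->
    (forall x, has (fun c => x == c.1 %[mod c.2])%N A) ->
    D%:R <= expR (c * ln (s + 1)%:R ^+ 2 / ln (ln (s + 2)%:R)).
Proof.
have [C C1 hC] := pair_sum_le_geometric R.
have C0 : 0 < C by apply: lt_le_trans C1.
have B0 : 0 < 64 * C * 4 by lra.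
(* With [K = a * l], the power [(3/4) ^ K] beats both [64 * C] and [s ^ 2 <= 4 ^ l]. *)
have [a a1 ha] := ex_geometric_lt B0.
have l2 : 0 < ln 2 :> R by rewrite ln_gt0 // ltr1n.
have aR : 0 < a%:R :> R by rewrite ltr0n ltnW.
(* 240 is 60 times 4: the condition on D below reads [60 K ^ 2 ln 2 <= ln K ln D], and
   [K ln 2 <= 2 a L]. *)
exists (240 * a%:R ^+ 2 / ln 2).
  by apply: divr_gt0 l2; apply: mulr_gt0 (exprn_gt0 2 aR); rewrite ltr0n.
move=> A s D s0 hs hD cov; set L := ln (s + 1)%:R; set M := ln (ln (s + 2)%:R).
rewrite leNgt; apply/negP => Dbig.
have D0 : (0 < D)%N by rewrite -(ltr0n R); apply: lt_trans (expR_gt0 _) Dbig.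
have M0 : 0 < M.
  apply: lt_le_trans (ln_ln3_gt0 R) _.
  have ln3 : 0 < ln 3 :> R by rewrite ln_gt0 // ltr1n.
  have le3 : ln 3 <= ln (s + 2)%:R :> R.
    by rewrite ler_ln ?posrE ?ltr0n ?ler_nat ?addn2.
  by rewrite ler_ln ?posrE // (lt_le_trans ln3).
have [l [l0 sl lL l2L]] := ex_dyadic_scale R s0.
pose K := (a * l)%N; have lK : (l <= K)%N by rewrite leq_pmull // ltnW.
have K1 : (1 < K)%N by rewrite (leq_trans a1) // leq_pmulr.
have K0 : 0 < K%:R :> R by rewrite ltr0n ltnW.
(* From [ln (s + 2) <= 2 l <= a l], which is where [a >= 2] enters. *)
have MK : M <= ln K%:R.
  rewrite ler_ln ?posrE //; first by apply: (le_trans l2L); rewrite ler_nat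
      leq_mul2r a1 orbT.
  by rewrite ln_gt0 // ltr1n addn2.
have Kub : K%:R * ln 2 <= 2 * a%:R * L.
  by rewrite natrM -!mulrA [2 * _]mulrCA ler_wpM2l // ltW.
(* 28 K offsets the Rankin bound; the remaining 2 K beats the factor s and the constant 4. *)
have exponent : 30 * K%:R <= ln K%:R / (2 * K%:R * ln 2) * ln D%:R :> R.
  have h1 : 240 * a%:R ^+ 2 / ln 2 * L ^+ 2 / M < ln D%:R.
    by rewrite -ltr_expR lnK ?posrE ?ltr0n.
  have h2 : 60 * K%:R ^+ 2 * ln 2 / M <= 240 * a%:R ^+ 2 / ln 2 * L ^+ 2 / M.
    rewrite ler_wpM2r ?invr_ge0 ?(ltW M0) //.
    rewrite [leRHS]mulrAC ler_pdivlMr //.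
    have : (K%:R * ln 2) ^+ 2 <= (2 * a%:R * L) ^+ 2.
      rewrite lerXn2r ?nnegrE //; first by rewrite mulr_ge0 // ltW.
      by apply: le_trans Kub; rewrite mulr_ge0 // ltW.
    by rewrite !exprMn; move: (a%:R ^+ 2) (L ^+ 2) => u v; lra.
  rewrite mulrAC ler_pdivlMr ?mulr_gt0 //.
  have h3 : 60 * K%:R ^+ 2 * ln 2 <= M * ln D%:R.
    by rewrite [leRHS]mulrC -ler_pdivrMr // (le_trans h2) // ltW.
  have lD0 : 0 <= ln D%:R :> R by rewrite ln_ge0 // ler1n.
  apply: (@le_trans _ _ (M * ln D%:R)); last by rewrite ler_wpM2r.
  by apply: le_trans h3; rewrite expr2; lra.
(* G bounds every modulus, hence all exponents and prime factors; since [G < 2 ^ G], the primes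
   below [2 ^ (K + G)] include them all. *)
pose G := (\sum_(d <- unzip2 A) d)%N.
have hDle d : d \in unzip2 A -> (D <= d)%N by move/hD/andP=> [].
have h0 := @sieved_uniform R G A s D (2 ^ K) hs hDle.
have [F [[_ Fmono F1] _ Feta]] := sieved_tail G (ltW C0) (hC G) hs h0.
have small_primes : s%:R * \sum_(d <- smooth_seq G (2 ^ K) | (D <= d)%N)
    d%:R^-1 <= 4^-1 :> R.
  have e2 : 2 <= expR 1 :> R by apply: le_trans (expR_ge1Dx _); lra.
  have e2X n : 2 ^+ n <= expR n%:R :> R.
    by rewrite -[n%:R]mulr1 expRM_natl lerXn2r ?nnegrE ?expR_ge0.
  have sK : s%:R <= expR K%:R :> R.
    apply: (le_trans sl); apply: (le_trans (e2X l)).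
    by rewrite ler_expR ler_nat.
  have K4 : 4 <= expR K%:R :> R.
    apply: (@le_trans _ _ (2 ^+ 2)); first by rewrite expr2; lra.
    by apply: le_trans (e2X 2%N) _; rewrite ler_expR ler_nat.
  have h := @sum_smooth_recip_le R G K D K1 D0.
  apply: (@le_trans _ _ (expR K%:R * expR (- 2 * K%:R))).
    apply: ler_pM => //; first by rewrite sumr_ge0 // => d _; rewrite invr_ge0.
    by apply: (le_trans h); rewrite ler_expR; lra.
  rewrite -expRD (_ : _ + _ = - K%:R); last by ring.
  by rewrite expRN lef_pV2 ?posrE ?expR_gt0.
have large_primes : 16 * s%:R ^+ 2 * C * (3 / 4) ^+ K <= 4^-1.
  apply: (@le_trans _ _ (4^-1 * (64 * C * 4 * (3 / 4) ^+ a) ^+ l)); last first.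
    rewrite ler_piMr // exprn_ile1 // !mulr_ge0 ?exprn_ge0 //; try lra.
  set w := (3 / 4) ^+ a.
  have -> : (3 / 4) ^+ K = w ^+ l by rewrite /K exprM.
  have w0 : 0 <= w by rewrite exprn_ge0 //; lra.
  rewrite [(_ * w) ^+ l]exprMn [(_ * 4) ^+ l]exprMn.
  have s2 : s%:R ^+ 2 <= 4 ^+ l :> R.
    apply: (@le_trans _ _ ((2 ^+ l) ^+ 2)).
      by rewrite lerXn2r ?nnegrE ?exprn_ge0.
    rewrite -exprM mulnC exprM (_ : 2 ^+ 2 = 4 :> R) //.
    by rewrite expr2; ring.
  have C2 : 64 * C <= (64 * C) ^+ l by rewrite ler_eXnr //; lra.
  have h : s%:R ^+ 2 * (64 * C) <= 4 ^+ l * (64 * C) ^+ l.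
    by rewrite ler_pM ?exprn_ge0 //; lra.
  have := ler_wpM2r (exprn_ge0 l w0) h.
  by move: (s%:R ^+ 2) (w ^+ l) (4 ^+ l) ((64 * C) ^+ l) => x y z t; lra.
have dM d : d \in unzip2 A -> (d %| smooth_mod G (2 ^ (K + G)))%N.
  move=> dA; have dG : (d <= G)%N by rewrite /G (big_rem d) //= leq_addr.
  have /andP[d0 _] := hD d dA.
  apply: dvd_smooth_mod => [|p pp pd]; first by rewrite d0.
  apply: leq_ltn_trans (leq_trans (dvdn_leq d0 pd) dG) _.
  by apply: leq_trans (ltn_expl G (ltnSn 1)) _; rewrite leq_exp2l // leq_addl.
(* Everything is covered, so the mass is at least 1, against an upper bound of [1/4 + 1/4]. *)
have : 1 <= F (fun x => (covered A (smooth_mod G (2 ^ (K + G))) x)%:R).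
  rewrite -[leLHS]F1; apply: Fmono => x; rewrite (_ : covered _ _ x) //.
  have /hasP[c cA cx] := cov x; apply/hasP; exists c => //.
  by rewrite cx andbT dM // map_f.
move=> h1; have := le_trans h1 (le_trans Feta (lerD small_primes
    large_primes)); lra.
Qed.

(** * From covering systems to lists of natural residues *)

Lemma smallest_modulus_le (A : seq (int * nat)) d :
  d \in moduli A -> (smallest_modulus A <= d)%N.
Proof.
(* The default value depends on the list, so it is generalised before the induction. *)
rewrite /smallest_modulus; move: (head 0%N _) => z.
elim: (moduli A) => // e s IHs; rewrite inE big_cons => /orP[/eqP ->|/IHs h].
  exact: geq_minl.
exact: leq_trans (geq_minr _ _) h.
Qed.

Lemma count_le_multiplicity (A : seq (int * nat)) d :
  (count_mem d (moduli A) <= multiplicity A)%N.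
Proof.
have [dA|dA] := boolP (d \in moduli A); last by rewrite (count_memPn dA).
by rewrite /multiplicity; apply: (@leq_bigmax_seq _ _ _ (fun e => count_mem e
    (moduli A))).
Qed.

Theorem theorem3 (R : realType) :
  exists2 c : R, 0 < c &
    forall (A : seq (int * nat)) (s : nat),
      covering_system A -> multiplicity A = s ->
      (smallest_modulus A)%:R <=
        expR (c * ln (s + 1)%:R ^+ 2 / ln (ln (s + 2)%:R)).
Proof.
have [c c0 hc] := min_modulus_le R; exists c => // A s [Apos _ Acov] As.
(* Each integer representative is replaced by its residue, a natural number in the same class. *)
pose A' := [seq (`|(x.1 %% x.2)%Z|%N, x.2) | x : int * nat <- A].
have modA' : unzip2 A' = moduli A by rewrite /unzip2 -map_comp.
have cov x : exists2 r, r \in A & ((x : int) = r.1 %[mod r.2])%Z.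
  have : [set: int]%classic x by [].
  by rewrite -Acov => -[r rA xr]; exists r.
apply: (hc A'); rewrite ?modA'.
- have [r rA _] := cov 0; rewrite -As.
  apply: leq_trans (count_le_multiplicity A r.2).
  by rewrite -has_count has_pred1 map_f.
- by move=> d; rewrite -As count_le_multiplicity.
- by move=> d dA; rewrite Apos // smallest_modulus_le.
- move=> x; have [r rA xr] := cov x; apply/hasP.
  exists (`|(r.1 %% r.2)%Z|%N, r.2) => /=; first by apply: map_f.
  by rewrite -xr modz_nat absz_nat modn_mod.
Qed.
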